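(* Let $X$ be a $UCW$-hyperbolic space with a monotone modulus of uniform convexity $\delta$, and let $C \subseteq X$ be nonempty and convex. Let $r\in\mathbb{N}$, $r\ge 2$, and let $\alpha=(\alpha_1,\ldots,\alpha_r)$ with $\alpha_i\in(0,1)$ and $\sum_{i=1}^r\alpha_i=1$. For $i = 1, \ldots, r$, let $C_i \subseteq C$ with $\bigcap_{i = 1}^r C_i \ne \emptyset$, let $P_i : C \to C_i$ be nonexpansive retractions, let $\lambda_i\in(0,1)$, and define $T_i : C \to C$ by $T_i = (1-\lambda_i) I + \lambda_i P_i$. Put $\lambda=(\lambda_1,\ldots,\lambda_r)$. Let $T:C\to C$ be the iterated convex combination of $T_1,\dots,T_r$ with weight $\alpha$ (defined in the context). Let $x \in C$ and $b > 0$ be such that there exists $p \in \bigcap_{i = 1}^r C_i$ with $d(x,p) \le b$. Then for all $\varepsilon > 0$ and all $n \ge \Phi(\varepsilon, b, \delta, \lambda, \alpha)$, $$d\left(T^n x, T^{n+1} x\right) \le \varepsilon,$$ where $$\Phi(\varepsilon, b, \delta, \lambda, \alpha):=\begin{cases}\left[\dfrac{b}{\varepsilon\, K\, \delta\left(b,\varepsilon/b\right)}\right] & \text{if }\varepsilon<2b, \\ 0 & \text{otherwise},\end{cases}$$ with $K = \min\{\alpha_i \lambda_i (1-\lambda_i) : i = 1, \ldots, r\}$.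
   Context: $[\,\cdot\,]$ denotes the integer part. A $W$-hyperbolic space is a triple $(X,d,W)$ with $(X,d)$ a metric space and $W:X\times X\times[0,1]\to X$ such that for all $x,y,z,w\in X$, $t,t'\in[0,1]$: (W1) $d(z,W(x,y,t))\le(1-t)d(z,x)+t\,d(z,y)$; (W2) $d(W(x,y,t),W(x,y,t'))=|t-t'|d(x,y)$; (W3) $W(x,y,t)=W(y,x,1-t)$; (W4) $d(W(x,z,t),W(y,w,t))\le(1-t)d(x,y)+t\,d(z,w)$. Write $(1-t)x+ty:=W(x,y,t)$. It is uniformly convex if for any $r>0$ and $\varepsilon\in(0,2]$ there is $\delta\in(0,1]$ such that for all $a,x,y\in X$ with $d(x,a)\le r$, $d(y,a)\le r$, $d(x,y)\ge\varepsilon r$ one has $d(\tfrac12x+\tfrac12y,a)\le(1-\delta)r$. A mapping $\delta:(0,\infty)\times(0,2]\to(0,1]$ providing such $\delta=\delta(r,\varepsilon)$ is a modulus of uniform convexity; it is monotone if for every fixed $\varepsilon$ it decreases (not necessarily strictly) with respect to $r$. A $UCW$-hyperbolic space is a uniformly convex $W$-hyperbolic space admitting a monotone modulus of uniform convexity. Such spaces are uniquely geodesic (indeed Busemann convex), and $(1-t)x+ty$ is the unique point $z$ of the geodesic segment $[x,y]$ with $d(z,x)=t\,d(x,y)$. $C$ is convex if it contains the geodesic segment joining any two of its points. A map $P:C\to C_i$ is a retraction if $Pz=z$ for all $z\in C_i$; nonexpansive means $1$-Lipschitz; $I$ is the identity map; convex combinations of maps are taken pointwise. Iterated convex combination: put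 $a_j=\sum_{i=j}^r\alpha_i$ for $j=1,\ldots,r$; $S_0:=T_r$; if $r\ge3$, for $i=1,\ldots,r-2$, $S_i:=\frac{\alpha_{r-i}}{a_{r-i}}T_{r-i}+\frac{a_{r-i+1}}{a_{r-i}}S_{i-1}$; and $T:=(1-a_2)T_1+a_2S_{r-2}$. (Each $S_i$ and $T$ maps $C$ to $C$; in a normed space $T=\sum_{i=1}^r\alpha_iT_i$.) *)

(* Defs.v *)
From mathcomp Require Import all_boot all_order all_algebra.
From mathcomp Require Import boolp classical_sets functions reals.
From mathcomp Require Import topology.

Set Implicit Arguments.
Unset Strict Implicit.
Unset Printing Implicit Defensive.

Import Order.TTheory GRing.Theory Num.Theory.

Local Open Scope classical_set_scope.
Local Open Scope ring_scope.

(* [W x y t] stands for $(1-t)x + ty$, so [t] is the weight of the second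
   point.  It is meaningful only for [t] in [0, 1]; the values elsewhere are
   left unconstrained. *)
Definition W_hyperbolic (R : realType) (X : metricType R)
    (W : X -> X -> R -> X) : Prop :=
  [/\ forall x y z t, 0 <= t <= 1 ->
        mdist z (W x y t) <= (1 - t) * mdist z x + t * mdist z y,
      forall x y t t', 0 <= t <= 1 -> 0 <= t' <= 1 ->
        mdist (W x y t) (W x y t') = `|t - t'| * mdist x y,
      forall x y t, 0 <= t <= 1 -> W x y t = W y x (1 - t) &
      forall x y z w t, 0 <= t <= 1 ->
        mdist (W x z t) (W y w t) <= (1 - t) * mdist x y + t * mdist z w].

(* The condition on a single value [delta] = $\delta(r,\varepsilon)$. *)
Definition uc_at (R : realType) (X : metricType R) (W : X -> X -> R -> X)
    (r eps delta : R) : Prop :=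
  0 < delta <= 1 /\
  forall a x y : X, mdist x a <= r -> mdist y a <= r ->
    eps * r <= mdist x y -> mdist (W x y (1 / 2)) a <= (1 - delta) * r.

Definition uniformly_convex (R : realType) (X : metricType R)
    (W : X -> X -> R -> X) : Prop :=
  forall r eps : R, 0 < r -> 0 < eps <= 2 -> exists delta, uc_at W r eps delta.

(* A modulus is a function on (0, oo) x (0, 2]; it is represented by a total
   function whose values outside that domain are irrelevant. *)
Definition uc_modulus (R : realType) (X : metricType R)
    (W : X -> X -> R -> X) (delta : R -> R -> R) : Prop :=
  forall r eps : R, 0 < r -> 0 < eps <= 2 -> uc_at W r eps (delta r eps).

Definition monotone_modulus (R : realType) (delta : R -> R -> R) : Prop :=
  forall eps r s : R, 0 < eps <= 2 -> 0 < r -> r <= s ->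
    delta s eps <= delta r eps.

Definition UCW_hyperbolic (R : realType) (X : metricType R)
    (W : X -> X -> R -> X) : Prop :=
  [/\ W_hyperbolic W, uniformly_convex W &
      exists delta, uc_modulus W delta /\ monotone_modulus delta].

Definition geodesic_segment (R : realType) (X : metricType R)
    (x y : X) (S : set X) : Prop :=
  exists (l : R) (gamma : R -> X),
    [/\ 0 <= l, gamma 0 = x, gamma l = y,
        forall s t, 0 <= s <= l -> 0 <= t <= l ->
          mdist (gamma s) (gamma t) = `|s - t| &
        S = gamma @` [set s | 0 <= s <= l]].

(* In a uniquely geodesic space there is exactly one such [S]. *)
Definition geodesically_convex (R : realType) (X : metricType R)
    (C : set X) : Prop :=
  forall x y S, C x -> C y -> geodesic_segment x y S -> S `<=` C.

(* A map on a subset [C] is represented by a total map [X -> X] of which only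
   the restriction to [C] matters. *)
Definition retraction_onto (X : Type) (C D : set X) (P : X -> X) : Prop :=
  set_fun C D P /\ forall z, D z -> P z = z.

Definition nonexpansive_on (R : realType) (X : metricType R)
    (C : set X) (f : X -> X) : Prop :=
  forall x y, C x -> C y -> mdist (f x) (f y) <= mdist x y.

Definition conv_maps (R : realType) (X : metricType R) (W : X -> X -> R -> X)
    (f g : X -> X) (t : R) : X -> X :=
  fun x => W (f x) (g x) t.

(* Families indexed by $1,\ldots,r$ are functions on [nat] used only at
   indices [i] with [1 <= i <= r]. *)
Definition tail_weight (R : realType) (r : nat) (alpha : nat -> R)
    (j : nat) : R :=
  \sum_(j <= i < r.+1) alpha i.

(* The coefficient of [T (r - i)] in $S_i$ is
   $\alpha_{r-i}/a_{r-i} = 1 - a_{r-i+1}/a_{r-i}$. *)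
Fixpoint partial_comb (R : realType) (X : metricType R)
    (W : X -> X -> R -> X) (r : nat) (alpha : nat -> R) (T : nat -> X -> X)
    (i : nat) : X -> X :=
  if i is i'.+1 then
    conv_maps W (T (r - i)%N) (partial_comb W r alpha T i')
      (tail_weight r alpha (r - i).+1 / tail_weight r alpha (r - i)%N)
  else T r.

Definition iterated_comb (R : realType) (X : metricType R)
    (W : X -> X -> R -> X) (r : nat) (alpha : nat -> R) (T : nat -> X -> X) :
    X -> X :=
  conv_maps W (T 1%N) (partial_comb W r alpha T (r - 2)%N)
    (tail_weight r alpha 2).

(* The range is nonempty for [r >= 1], so seeding the iterated minimum with its
   first term does not change the value. *)
Definition min_coef (R : realType) (r : nat) (lambda alpha : nat -> R) : R :=
  \big[Num.min/alpha 1%N * lambda 1%N * (1 - lambda 1%N)]_(1 <= i < r.+1)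
    (alpha i * lambda i * (1 - lambda i)).

Definition Phi (R : realType) (eps b : R) (delta : R -> R -> R)
    (r : nat) (lambda alpha : nat -> R) : int :=
  if eps < 2 * b then
    Num.floor (b / (eps * min_coef r lambda alpha * delta b (eps / b)))
  else 0.

(* Main.v *)
Require Import Defs.
From mathcomp Require Import all_boot all_order all_algebra.
From mathcomp Require Import boolp classical_sets functions reals.
From mathcomp Require Import topology.
From mathcomp Require Import ring lra.

Set Implicit Arguments.
Unset Strict Implicit.
Unset Printing Implicit Defensive.

Import Order.TTheory GRing.Theory Num.Theory.

Local Open Scope classical_set_scope.
Local Open Scope ring_scope.

(** Let [p] be a common point of the sets [Ci i] with [mdist x p <= b].

    In a uniformly convex W-hyperbolic space, a point between two others is
    determined by its distances to them ([unique_between]), so that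
    [W x y t] is also the point of parameter [2 * t] between [x] and the
    midpoint ([W_half]). This upgrades the uniform
    convexity inequality from midpoints to arbitrary convex combinations with
    the gain [2 t (1 - t) delta] ([uc_comb_le]).

    By joint convexity of the metric, the distance between two iterated convex
    combinations is at most the weighted sum of the distances between their
    components ([iterated_comb_dist]). Taking suitable components shows that
    [T] is nonexpansive, that [mdist z (T z)] is at most the
    weighted mean of the [mdist z (Ti i z)], and that [mdist (T z) p] is at
    most the weighted mean of the [mdist (Ti i z) p].

    Suppose [eps < mdist z (T z)] for some [z] with [mdist z p <= b]. Then
    [eps < mdist z (Ti i z)] for some [i], and for this [i] uniform convexity
    in the ball of radius [mdist z p] about [p] gives
    [mdist (Ti i z) p <=
     mdist z p - lambda i (1 - lambda i) eps delta(b, eps/b)]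
    ([averaged_decrease]): monotonicity of [delta] passes from the radius
    [mdist z p] to [b], and [mdist z p > eps / 2] absorbs the factor 2 of
    [uc_comb_le]. The other components do not move away from [p], so [T]
    decreases the distance to [p] by at least [D = eps K delta(b, eps/b)].

    The displacements [mdist (T^n x) (T^n.+1 x)] are nonincreasing in [n]. If
    the one of index [n] exceeded [eps], the first [n + 1] steps would all
    decrease the distance to [p] by [D], whence [(n + 1) D <= b], which
    contradicts [floor (b / D) <= n]. When [2 b <= eps] the bound is the
    triangle inequality through [p]. *)

(** * W-hyperbolic spaces *)

Lemma W_id (R : realType) (X : metricType R) (W : X -> X -> R -> X)
    (hW : W_hyperbolic W) (x : X) (t : R) :
  0 <= t <= 1 -> W x x t = x.
Proof.
case: hW => W1 _ _ _ ht; apply/esym/mdist_positivity/le_anti.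
by rewrite mdist_ge0 andbT (le_trans (W1 x x x t ht)) // mdistxx !mulr0 addr0.
Qed.

Lemma mdist_Wl (R : realType) (X : metricType R) (W : X -> X -> R -> X)
    (hW : W_hyperbolic W) (x y : X) (t : R) :
  0 <= t <= 1 -> mdist x (W x y t) = t * mdist x y.
Proof.
case: hW => W1 W2 _ _ ht; have h0 : 0 <= (0 : R) <= 1 by rewrite lexx ler01.
have {1}-> : x = W x y 0.
  apply/mdist_positivity/le_anti; rewrite mdist_ge0 andbT.
  by rewrite (le_trans (W1 x y x 0 h0)) // mdistxx mulr0 mul0r addr0.
by rewrite W2 // sub0r normrN ger0_norm //; case/andP: ht.
Qed.

Lemma mdist_Wr (R : realType) (X : metricType R) (W : X -> X -> R -> X)
    (hW : W_hyperbolic W) (x y : X) (t : R) :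
  0 <= t <= 1 -> mdist (W x y t) y = (1 - t) * mdist x y.
Proof.
move=> ht; have [_ _ W3 _] := hW.
by rewrite W3 // metric_sym mdist_Wl ?[mdist y x]metric_sym //; lra.
Qed.

Lemma mdist_W_le (R : realType) (X : metricType R) (W : X -> X -> R -> X)
    (hW : W_hyperbolic W) (x y a : X) (t : R) :
  0 <= t <= 1 ->
  mdist (W x y t) a <= (1 - t) * mdist x a + t * mdist y a.
Proof.
by case: hW => W1 _ _ _ ht; rewrite !(metric_sym _ a); exact: W1.
Qed.

(** A geodesically convex set is closed under [W], because the points
    [W x y t] for [t] in [0, 1] form a geodesic segment from [x] to [y]. *)
Lemma convex_W (R : realType) (X : metricType R) (W : X -> X -> R -> X)
    (hW : W_hyperbolic W) (C : set X) (hC : geodesically_convex C)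
    (x y : X) (t : R) :
  C x -> C y -> 0 <= t <= 1 -> C (W x y t).
Proof.
move=> Cx Cy ht.
have [xy|xy] := eqVneq x y; first by rewrite -xy W_id.
have l0 : 0 < mdist x y by rewrite mdist_gt0.
set l := mdist x y in l0 *.
have scale s : 0 <= s <= l -> 0 <= s / l <= 1.
  by case/andP=> s0 sl; rewrite divr_ge0 ?(ltW l0) //= ler_pdivrMr // mul1r.
have [_ W2 _ _] := hW.
apply: (hC x y [set W x y (s / l) | s in [set s | 0 <= s <= l]]) => //.
- exists l, (fun s => W x y (s / l)); split => //.
  + exact: ltW.
  + apply/esym/mdist_positivity.
    by rewrite mdist_Wl // mul0r ?mul0r // lexx ler01.
  + apply: mdist_positivity; rewrite mdist_Wr // divff ?gt_eqF //; last first.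
      by rewrite ler01 lexx.
    by rewrite subrr mul0r.
  + move=> s s' hs hs'; rewrite W2 ?scale // -mulrBl normrM -/l.
    by rewrite (gtr0_norm (x := l^-1)) ?invr_gt0 // mulfVK ?gt_eqF.
- exists (t * l); last by rewrite mulfK ?gt_eqF.
  case/andP: ht => t0 t1 /=.
  by rewrite mulr_ge0 ?(ltW l0) //= ler_piMl // ltW.
Qed.

(** * Uniform convexity *)

(** Two points at distance at most [s] from [x] and at most [t] from [y] agree
    when [s + t <= mdist x y]: otherwise their midpoint would be at distance
    less than [s] from [x], and still at most [t] from [y]. *)
Lemma unique_between (R : realType) (X : metricType R)
    (W : X -> X -> R -> X) (hW : W_hyperbolic W) (hu : uniformly_convex W)
    (x y u v : X) (s t : R) :
  mdist u x <= s -> mdist v x <= s -> mdist u y <= t -> mdist v y <= t ->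
  s + t <= mdist x y -> u = v.
Proof.
move=> ux vx uy vy stxy; apply: contrapT => /eqP uv.
have e0 : 0 < mdist u v by rewrite mdist_gt0.
have tri : mdist u v <= mdist u x + mdist v x.
  by rewrite (metric_sym v); exact: metric_triangle.
have s0 : 0 < s by lra.
have he : 0 < mdist u v / s <= 2.
  by rewrite divr_gt0 //= ler_pdivrMr //; lra.
have [d [/andP[d0 _] hd]] := hu s _ s0 he.
have hm := hd x u v ux vx; rewrite divfK ?gt_eqF // in hm.
have {}hm := hm (lexx _).
have h12 : 0 <= (1 / 2 : R) <= 1 by lra.
have my := mdist_W_le hW u v y h12.
have := metric_triangle x (W u v (1 / 2)) y; rewrite (metric_sym x (W _ _ _)).
have := mulr_gt0 d0 s0; lra.
Qed.

(** Both sides lie at distance [t * mdist x y] from [x] and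
    [(1 - t) * mdist x y] from [y]. *)
Lemma W_half (R : realType) (X : metricType R) (W : X -> X -> R -> X)
    (hW : W_hyperbolic W) (hu : uniformly_convex W) (x y : X) (t : R) :
  0 <= t <= 1 / 2 -> W x y t = W x (W x y (1 / 2)) (2 * t).
Proof.
move=> ht.
have t1 : 0 <= t <= 1 by lra.
have t2 : 0 <= 2 * t <= 1 by lra.
have h12 : 0 <= (1 / 2 : R) <= 1 by lra.
apply: (unique_between hW hu (x := x) (y := y) (s := t * mdist x y)
  (t := (1 - t) * mdist x y)).
- by rewrite metric_sym mdist_Wl.
- by rewrite metric_sym !mdist_Wl //; lra.
- by rewrite mdist_Wr.
- apply: (le_trans (mdist_W_le hW _ _ _ t2)).
  by rewrite mdist_Wr //; lra.
- by lra.
Qed.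

(** Uniform convexity for arbitrary convex combinations. For [t <= 1 / 2], the
    combination is taken between [x] and the midpoint of [x] and [y], which
    yields the gain [2 * t * delta]; the other case is symmetric. *)
Lemma uc_comb_le (R : realType) (X : metricType R) (W : X -> X -> R -> X)
    (hW : W_hyperbolic W) (hu : uniformly_convex W)
    (r eps delta : R) (hd : uc_at W r eps delta) (a x y : X) (t : R) :
  mdist x a <= r -> mdist y a <= r -> eps * r <= mdist x y -> 0 <= t <= 1 ->
  mdist (W x y t) a <= (1 - 2 * t * (1 - t) * delta) * r.
Proof.
move=> xa ya exy.
have [/andP[d0 d1] {}hd] := hd.
have dr0 : 0 <= delta * r.
  by rewrite mulr_ge0 ?(ltW d0) // (le_trans (mdist_ge0 _ _) xa).
wlog ht : x y t xa ya exy / t <= 1 / 2.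
  move=> hwlog ht; have [t12|t12] := leP t (1 / 2); first exact: hwlog.
  have [_ _ W3 _] := hW; rewrite W3 //.
  have -> : 2 * t * (1 - t) = 2 * (1 - t) * (1 - (1 - t)) by ring.
  by apply: hwlog => //; rewrite 1?metric_sym //; lra.
move=> /andP[t0 t1]; rewrite W_half //; last by rewrite t0.
have t2 : 0 <= 2 * t <= 1 by lra.
apply: (le_trans (mdist_W_le hW _ _ _ t2)).
have hm := hd a x y xa ya exy.
have h1 : (1 - 2 * t) * mdist x a <= (1 - 2 * t) * r by apply: ler_wpM2l; lra.
have h2 : 2 * t * mdist (W x y (1 / 2)) a <= 2 * t * ((1 - delta) * r).
  by apply: ler_wpM2l; lra.
have : 0 <= (t * t) * (delta * r) by rewrite mulr_ge0 // mulr_ge0.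
lra.
Qed.

(** * Iterated convex combinations *)

Lemma tail_weight_recl (R : realType) (r : nat) (alpha : nat -> R) (j : nat) :
  (j <= r)%N -> tail_weight r alpha j = alpha j + tail_weight r alpha j.+1.
Proof. by move=> jr; rewrite /tail_weight big_ltn. Qed.

Lemma tail_weight_gt0 (R : realType) (r : nat) (alpha : nat -> R)
    (halpha : forall i, (1 <= i <= r)%N -> 0 < alpha i < 1) (j : nat) :
  (1 <= j <= r)%N -> 0 < tail_weight r alpha j.
Proof.
move=> /[dup] /andP[j1 jr] hj; rewrite tail_weight_recl //.
rewrite ltr_pwDl //; first by case/andP: (halpha j hj).
rewrite /tail_weight big_nat_cond sumr_ge0 // => i.
rewrite andbT ltnS => /andP[ji ir].
have /halpha/andP[/ltW //] : (1 <= i <= r)%N.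
by rewrite ir (leq_trans j1 (ltnW ji)).
Qed.

Lemma tail_ratio_itv (R : realType) (r : nat) (alpha : nat -> R)
    (halpha : forall i, (1 <= i <= r)%N -> 0 < alpha i < 1) (j : nat) :
  (1 <= j < r)%N ->
  0 <= tail_weight r alpha j.+1 / tail_weight r alpha j <= 1.
Proof.
move=> /andP[j1 jr].
have hj : (1 <= j <= r)%N by rewrite j1 ltnW.
have a0 := tail_weight_gt0 halpha hj.
have a1 : 0 < tail_weight r alpha j.+1 by apply: tail_weight_gt0.
rewrite divr_ge0 ?(ltW a0) ?(ltW a1) //= ler_pdivrMr // mul1r.
rewrite (tail_weight_recl _ (ltnW jr)).
by rewrite lerDr; case/andP: (halpha j hj) => /ltW.
Qed.

(** Since the weights sum to 1, the last step of the iterated combination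
    follows the same pattern as the previous ones. *)
Lemma iterated_combE (R : realType) (X : metricType R) (W : X -> X -> R -> X)
    (r : nat) (alpha : nat -> R) (T : nat -> X -> X) :
  (2 <= r)%N -> \sum_(1 <= i < r.+1) alpha i = 1 ->
  iterated_comb W r alpha T = partial_comb W r alpha T r.-1.
Proof.
case: r => [|[|r]] // _ a1; rewrite /iterated_comb !subSS subn0 /=.
have -> : (r.+2 - r.+1 = 1)%N by rewrite subSS subSnn.
by rewrite [X in _ / X]a1 divr1.
Qed.

Lemma partial_comb_in (R : realType) (X : metricType R)
    (W : X -> X -> R -> X) (r : nat) (alpha : nat -> R)
    (halpha : forall i, (1 <= i <= r)%N -> 0 < alpha i < 1)
    (C : set X) (hC : forall x y t, C x -> C y -> 0 <= t <= 1 -> C (W x y t))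
    (T : nat -> X -> X) (z : X)
    (hT : forall i, (1 <= i <= r)%N -> C (T i z)) (k : nat) :
  (k < r)%N -> C (partial_comb W r alpha T k z).
Proof.
elim: k => [|k IH] kr; first by apply: hT; rewrite kr leqnn.
apply: hC.
- by apply: hT; rewrite subn_gt0 kr leq_subr.
- exact/IH/ltnW.
- apply: tail_ratio_itv => //.
  by rewrite subn_gt0 kr /= ltn_subrL (leq_ltn_trans _ kr).
Qed.

(** The families [S] and [T] are independent, so that a constant family may
    be used to measure the distance to a fixed point. *)
Lemma partial_comb_dist (R : realType) (X : metricType R)
    (W : X -> X -> R -> X) (hW : W_hyperbolic W) (r : nat) (alpha : nat -> R)
    (halpha : forall i, (1 <= i <= r)%N -> 0 < alpha i < 1)
    (S T : nat -> X -> X) (z w : X) (k : nat) :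
  (k < r)%N ->
  tail_weight r alpha (r - k) *
    mdist (partial_comb W r alpha S k z) (partial_comb W r alpha T k w) <=
  \sum_(r - k <= i < r.+1) alpha i * mdist (S i z) (T i w).
Proof.
elim: k => [|k IH] kr.
  by rewrite /tail_weight subn0 !big_nat1 /=.
have k1 : (1 <= r - k.+1 < r)%N.
  by rewrite subn_gt0 kr /= ltn_subrL (leq_ltn_trans _ kr).
have a0 : 0 < tail_weight r alpha (r - k.+1).
  by apply: tail_weight_gt0 => //; rewrite subn_gt0 kr leq_subr.
rewrite big_ltn ?ltnS ?leq_subr //.
have [_ _ _ W4] := hW.
set t := tail_weight r alpha (r - k.+1).+1 / tail_weight r alpha (r - k.+1).
have ht : 0 <= t <= 1 by exact: tail_ratio_itv.
have at' : tail_weight r alpha (r - k.+1) * t = tail_weight r alpha (r - k).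
  by rewrite /t mulrC divfK ?gt_eqF // subnSK // ltnW.
have {}IH := IH (ltnW kr); rewrite subnSK ?(ltnW kr) //.
have a1 := tail_weight_recl alpha (leq_subr k.+1 r).
rewrite subnSK ?(ltnW kr) // in a1.
apply: le_trans (_ : tail_weight r alpha (r - k.+1) *
  ((1 - t) * mdist (S (r - k.+1)%N z) (T (r - k.+1)%N w) +
   t * mdist (partial_comb W r alpha S k z) (partial_comb W r alpha T k w))
  <= _).
  by rewrite ler_pM2l //; exact: W4.
clearbody t; rewrite mulrDr !mulrA mulrBr mulr1 at' a1 addrK.
by rewrite lerD2l.
Qed.

Lemma iterated_comb_dist (R : realType) (X : metricType R)
    (W : X -> X -> R -> X) (hW : W_hyperbolic W) (r : nat) (alpha : nat -> R)
    (halpha : forall i, (1 <= i <= r)%N -> 0 < alpha i < 1)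
    (halpha1 : \sum_(1 <= i < r.+1) alpha i = 1) (hr : (2 <= r)%N)
    (S T : nat -> X -> X) (z w : X) :
  mdist (iterated_comb W r alpha S z) (iterated_comb W r alpha T w) <=
  \sum_(1 <= i < r.+1) alpha i * mdist (S i z) (T i w).
Proof.
rewrite !iterated_combE //.
have r0 : (0 < r)%N by exact: ltnW.
have := partial_comb_dist hW halpha S T z w (k := r.-1).
by rewrite ltn_predL r0 -subn1 subKn // /tail_weight halpha1 mul1r => ->.
Qed.

Lemma iterated_comb_in (R : realType) (X : metricType R)
    (W : X -> X -> R -> X) (r : nat) (alpha : nat -> R)
    (halpha : forall i, (1 <= i <= r)%N -> 0 < alpha i < 1)
    (halpha1 : \sum_(1 <= i < r.+1) alpha i = 1) (hr : (2 <= r)%N)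
    (C : set X) (hC : forall x y t, C x -> C y -> 0 <= t <= 1 -> C (W x y t))
    (T : nat -> X -> X) (z : X)
    (hT : forall i, (1 <= i <= r)%N -> C (T i z)) :
  C (iterated_comb W r alpha T z).
Proof.
rewrite iterated_combE //; apply: partial_comb_in => //.
by rewrite ltn_predL ltnW.
Qed.

Lemma iterated_comb_const (R : realType) (X : metricType R)
    (W : X -> X -> R -> X) (hW : W_hyperbolic W) (r : nat) (alpha : nat -> R)
    (halpha : forall i, (1 <= i <= r)%N -> 0 < alpha i < 1)
    (halpha1 : \sum_(1 <= i < r.+1) alpha i = 1) (hr : (2 <= r)%N)
    (p z : X) (T : nat -> X -> X)
    (hT : forall i, (1 <= i <= r)%N -> T i z = p) :
  iterated_comb W r alpha T z = p.
Proof.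
apply: (@iterated_comb_in _ _ W r alpha halpha halpha1 hr [set p]) => //.
by move=> x y t /= -> ->; exact: W_id.
Qed.

(** A weighted mean of numbers at most [c], the [j]-th of which is below [c]
    by [gap]. *)
Lemma weighted_sum_gap (R : realType) (r : nat) (alpha F : nat -> R)
    (halpha : forall i, (1 <= i <= r)%N -> 0 < alpha i < 1)
    (halpha1 : \sum_(1 <= i < r.+1) alpha i = 1) (c gap : R) (j : nat) :
  (1 <= j <= r)%N -> (forall i, (1 <= i <= r)%N -> F i <= c) ->
  F j <= c - gap -> \sum_(1 <= i < r.+1) alpha i * F i <= c - alpha j * gap.
Proof.
move=> hj hF hFj.
have jr : j \in index_iota 1 r.+1 by rewrite mem_index_iota.
have rest : \sum_(1 <= i < r.+1 | i != j) alpha i * F i <=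
            (\sum_(1 <= i < r.+1 | i != j) alpha i) * c.
  rewrite mulr_suml big_nat_cond [leRHS]big_nat_cond ler_sum // => i.
  rewrite ltnS => /andP[hi _]; apply: ler_wpM2l; last exact: hF.
  by case/andP: (halpha i hi) => /ltW.
have sum1 := halpha1.
rewrite (bigD1_seq j) //= ?iota_uniq // in sum1.
rewrite (bigD1_seq j) //= ?iota_uniq //.
have aj : alpha j * F j <= alpha j * (c - gap).
  by apply: ler_wpM2l => //; case/andP: (halpha j hj) => /ltW.
apply: (le_trans (lerD aj rest)).
rewrite (_ : c - alpha j * gap =
  (alpha j + \sum_(1 <= i < r.+1 | i != j) alpha i) * c - alpha j * gap).
  lra.
by rewrite sum1 mul1r.
Qed.

Lemma weighted_sum_le (R : realType) (r : nat) (alpha F : nat -> R)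
    (halpha : forall i, (1 <= i <= r)%N -> 0 < alpha i < 1)
    (halpha1 : \sum_(1 <= i < r.+1) alpha i = 1) (hr : (1 <= r)%N) (c : R) :
  (forall i, (1 <= i <= r)%N -> F i <= c) ->
  \sum_(1 <= i < r.+1) alpha i * F i <= c.
Proof.
move=> hF; have h1 : (1 <= 1 <= r)%N by [].
have := weighted_sum_gap halpha halpha1 (gap := 0) h1 hF.
by rewrite mulr0 subr0; apply; exact: hF.
Qed.

(** * Averaged maps *)

Lemma min_coef_le (R : realType) (r : nat) (lambda alpha : nat -> R)
    (i : nat) :
  (1 <= i <= r)%N ->
  min_coef r lambda alpha <= alpha i * lambda i * (1 - lambda i).
Proof.
move=> hi; rewrite /min_coef.
by apply: (@ge_bigmin_seq _ _ _ _ _ i xpredT) => //; rewrite mem_index_iota.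
Qed.

Lemma min_coef_gt0 (R : realType) (r : nat) (lambda alpha : nat -> R) :
  (1 <= r)%N ->
  (forall i, (1 <= i <= r)%N -> 0 < alpha i < 1) ->
  (forall i, (1 <= i <= r)%N -> 0 < lambda i < 1) ->
  0 < min_coef r lambda alpha.
Proof.
move=> hr ha hl.
have pos i : (1 <= i <= r)%N -> 0 < alpha i * lambda i * (1 - lambda i).
  move=> hi; have /andP[a0 _] := ha i hi; have /andP[l0 l1] := hl i hi.
  by rewrite !mulr_gt0 // subr_gt0.
rewrite /min_coef big_nat_cond lt_bigmin ?pos // => i.
by rewrite andbT ltnS => /pos.
Qed.

Lemma averaged_mdist_le (R : realType) (X : metricType R)
    (W : X -> X -> R -> X) (hW : W_hyperbolic W) (l : R) (z q p : X) :
  0 <= l <= 1 -> mdist q p <= mdist z p -> mdist (W z q l) p <= mdist z p.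
Proof.
move=> l01 qz; apply: (le_trans (mdist_W_le hW _ _ _ l01)).
by have /andP[l0 _] := l01; move/(ler_wpM2l l0): qz; lra.
Qed.

(** One step of an averaged map: [q] plays the role of the image of [z] under
    a nonexpansive map fixing [p], and [W z q l] that of the image under the
    averaged map. The modulus is used at the radius [mdist z p] and at the
    ratio [eps / b], not [eps / mdist z p], because it is monotone in the
    radius only. *)
Lemma averaged_decrease (R : realType) (X : metricType R)
    (W : X -> X -> R -> X) (hW : W_hyperbolic W) (hu : uniformly_convex W)
    (delta : R -> R -> R)
    (hdelta : uc_modulus W delta) (hmono : monotone_modulus delta)
    (b eps l : R) (z q p : X) :
  0 < b -> 0 < eps < 2 * b -> 0 < l < 1 ->
  mdist z p <= b -> mdist q p <= mdist z p -> eps < mdist z (W z q l) ->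
  mdist (W z q l) p <=
    mdist z p - l * (1 - l) * (eps * delta b (eps / b)).
Proof.
move=> b0 /andP[e0 e2] /andP[l0 l1] zb qz hz.
have l01 : 0 <= l <= 1 by rewrite !ltW.
set rho := mdist z p in zb qz *.
have ezq : eps < mdist z q.
  apply: lt_le_trans hz _; rewrite mdist_Wl //.
  by rewrite ler_piMl ?mdist_ge0 // ltW.
(* [z] and [q] lie in the ball of radius [rho] about [p]. *)
have erho : eps < 2 * rho.
  have := metric_triangle z p q; rewrite (metric_sym p q) -/rho; lra.
have rho0 : 0 < rho by lra.
have hs : 0 < eps / b <= 2 by rewrite divr_gt0 //= ler_pdivrMr // ltW.
have hd := hdelta rho _ rho0 hs.
have sep : eps / b * rho <= mdist z q.
  apply: le_trans (ltW ezq); rewrite -mulrA ler_piMr ?(ltW e0) //.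
  by rewrite mulrC ler_pdivrMr // mul1r.
apply: (le_trans (uc_comb_le hW hu hd (lexx _) qz sep l01)).
have db : delta b (eps / b) <= delta rho (eps / b) by exact: hmono.
have d0 : 0 < delta b (eps / b) by case: (hdelta b _ b0 hs) => /andP[].
have ll0 : 0 <= l * (1 - l) by rewrite mulr_ge0 ?ltW // subr_gt0.
have h : eps * delta b (eps / b) <= 2 * rho * delta rho (eps / b).
  by apply: ler_pM => //; exact: ltW.
move/(ler_wpM2l ll0): h; lra.
Qed.

(** * Asymptotic regularity *)

Theorem theorem5p4 (R : realType) (X : metricType R) (W : X -> X -> R -> X)
    (hX : UCW_hyperbolic W)
    (delta : R -> R -> R)
    (hdelta : uc_modulus W delta) (hmono : monotone_modulus delta)
    (C : set X) (hC0 : C !=set0) (hC : geodesically_convex C)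
    (r : nat) (hr : (2 <= r)%N)
    (alpha : nat -> R)
    (halpha : forall i : nat, (1 <= i <= r)%N -> 0 < alpha i < 1)
    (halpha1 : \sum_(1 <= i < r.+1) alpha i = 1)
    (Ci : nat -> set X)
    (hCi : forall i : nat, (1 <= i <= r)%N -> Ci i `<=` C)
    (hcap : \bigcap_(i in [set i : nat | (1 <= i <= r)%N]) Ci i !=set0)
    (P : nat -> X -> X)
    (hP : forall i : nat, (1 <= i <= r)%N ->
       retraction_onto C (Ci i) (P i) /\ nonexpansive_on C (P i))
    (lambda : nat -> R)
    (hlambda : forall i : nat, (1 <= i <= r)%N -> 0 < lambda i < 1)
    (Ti : nat -> X -> X)
    (hTi : forall i : nat, (1 <= i <= r)%N ->
       forall z : X, C z -> Ti i z = conv_maps W id (P i) (lambda i) z)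
    (T : X -> X)
    (hT : forall z : X, C z -> T z = iterated_comb W r alpha Ti z)
    (x : X) (hx : C x) (b : R) (hb : 0 < b)
    (hp : exists p : X,
       (\bigcap_(i in [set i : nat | (1 <= i <= r)%N]) Ci i) p /\
       mdist x p <= b) :
  forall (eps : R) (n : nat), 0 < eps ->
    Phi eps b delta r lambda alpha <= n%:Z ->
    mdist (iter n T x) (iter n.+1 T x) <= eps.
Proof.
have [hW hu _] := hX.
have r1 : (1 <= r)%N by exact: ltnW.
have hCW x' y' t : C x' -> C y' -> 0 <= t <= 1 -> C (W x' y' t).
  exact: (convex_W hW hC).
have l01 i : (1 <= i <= r)%N -> 0 <= lambda i <= 1.
  by move=> /hlambda/andP[l0 l1]; rewrite !ltW.
have TiC i z : (1 <= i <= r)%N -> C z -> C (Ti i z).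
  move=> hi Cz; rewrite hTi //; apply: hCW; rewrite ?l01 //.
  by have [[PC _] _] := hP i hi; exact: hCi (PC _ Cz).
have Tin z : C z -> C (T z).
  by move=> Cz; rewrite hT //; apply: iterated_comb_in => // i /TiC; exact.
have iterC n : C (iter n T x) by elim: n => //= n /Tin.
have Tlip z w : C z -> C w -> mdist (T z) (T w) <= mdist z w.
  move=> Cz Cw; rewrite !hT //.
  apply: (le_trans (iterated_comb_dist hW halpha halpha1 hr _ _ _ _)).
  apply: weighted_sum_le => // i hi; rewrite !hTi //.
  have [_ _ _ W4] := hW; apply: (le_trans (W4 _ _ _ _ _ (l01 i hi))).
  have [_ Plip] := hP i hi; have := Plip _ _ Cz Cw => /=.
  have /andP[l0 _] := hlambda i hi; move=> /(ler_wpM2l (ltW l0)); lra.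
have [p [hpC xp]] := hp.
have Cp : C p by apply: (hCi 1%N) => //; exact: hpC.
have Tip i : (1 <= i <= r)%N -> Ti i p = p.
  move=> hi; rewrite hTi // /conv_maps /=.
  have [[_ Pid] _] := hP i hi.
  by rewrite Pid ?W_id // ?l01 //; exact: hpC.
have Pip i z : (1 <= i <= r)%N -> C z -> mdist (P i z) p <= mdist z p.
  move=> hi Cz; have [[_ Pid] Plip] := hP i hi.
  by have := Plip z p Cz Cp; rewrite (Pid p) //; exact: hpC.
have Tp : T p = p.
  by rewrite hT //; exact: (iterated_comb_const hW halpha halpha1 hr).
have fejer z : C z -> mdist (T z) p <= mdist z p.
  by move=> Cz; rewrite -{1}Tp; exact: Tlip.
have iterp n : mdist (iter n T x) p <= b.
  by elim: n => //= n; apply: le_trans; exact: fejer.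
move=> eps n e0; rewrite /Phi; case: ltP => [e2|e2] hn; last first.
  apply: le_trans e2; have := iterp n; have := iterp n.+1.
  have := metric_triangle (iter n T x) p (iter n.+1 T x).
  by rewrite (metric_sym p); lra.
set K := min_coef r lambda alpha in hn.
set d := delta b (eps / b) in hn.
have K0 : 0 < K by exact: min_coef_gt0.
have d0 : 0 < d.
  have /(hdelta b _ hb)[/andP[//]] : 0 < eps / b <= 2.
  by rewrite divr_gt0 //= ler_pdivrMr // ltW.
have ed0 : 0 < eps * d by rewrite mulr_gt0.
have D0 : 0 < eps * K * d by rewrite !mulr_gt0.
have step z : C z -> mdist z p <= b -> eps < mdist z (T z) ->
    mdist (T z) p <= mdist z p - eps * K * d.
  move=> Cz zb hz.
  have [i [hi hiz]] : exists i, (1 <= i <= r)%N /\ eps < mdist z (Ti i z).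
    apply: contrapT => no; move: hz; apply/negP; rewrite -leNgt.
    (* Write [z] as the iterated combination of identity maps. *)
    have {1}<- : iterated_comb W r alpha (fun=> id) z = z.
      exact: (iterated_comb_const hW halpha halpha1 hr).
    rewrite hT //.
    apply: (le_trans (iterated_comb_dist hW halpha halpha1 hr _ _ _ _)).
    apply: weighted_sum_le => // i hi; rewrite leNgt; apply/negP => hiz.
    by apply: no; exists i.
  (* Write [p] as the iterated combination of constant maps. *)
  have pE : iterated_comb W r alpha (fun=> cst p) z = p.
    exact: (iterated_comb_const hW halpha halpha1 hr).
  rewrite -{1}pE hT //.
  apply: (le_trans (iterated_comb_dist hW halpha halpha1 hr _ _ _ _)).
  apply: (le_trans (weighted_sum_gap halpha halpha1
    (gap := lambda i * (1 - lambda i) * (eps * d)) hi _ _)).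
  - move=> j hj /=; rewrite hTi //.
    by apply: averaged_mdist_le; rewrite ?l01 ?Pip.
  - rewrite hTi // /conv_maps /= in hiz *.
    by apply: averaged_decrease; rewrite ?e0 ?hlambda ?Pip.
  - have /(ler_wpM2r (ltW ed0)) := min_coef_le lambda alpha hi.
    rewrite -/K; clearbody K d; clear -d; lra.
(* The displacements are nonincreasing, as [T] is nonexpansive on [C]. *)
have mono m k : (k <= m)%N ->
    mdist (iter m T x) (iter m.+1 T x) <= mdist (iter k T x) (iter k.+1 T x).
  elim: m => [|m IH]; first by rewrite leqn0 => /eqP ->.
  rewrite leq_eqVlt => /predU1P[->//|km].
  exact: le_trans (Tlip _ _ (iterC m) (iterC m.+1)) (IH km).
rewrite leNgt; apply/negP => big.
have decr k : (k <= n.+1)%N -> mdist (iter k T x) p <= b - k%:R * (eps * K * d).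
  elim: k => [|k IH] kn; first by rewrite mul0r subr0.
  have := step _ (iterC k) (iterp k) (lt_le_trans big (mono n k kn)).
  have := IH (ltnW kn); rewrite iterS -natr1; lra.
have := decr _ (leqnn _); have := mdist_ge0 (iter n.+1 T x) p.
have : b / (eps * K * d) < n.+1%:R.
  have /andP[_ /lt_le_trans] := floor_itv (b / (eps * K * d)); apply.
  by rewrite -[n.+1%:R]/(n.+1%:Z%:~R) ler_int -addn1 PoszD lerD2r.
rewrite ltr_pdivrMr //; lra.
Qed.
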